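(* Let $X$ be a Banach space and let $Y=P(X)$ be a norm-one complemented subspace of $X$, i.e. the range of a contractive linear projection $P:X\to X$. If $X$ has property $\mathrm{(P1)}$ (respectively $(\overline{\mathrm{P1}})$, respectively $\mathrm{(co)}$), then $Y$ has property $\mathrm{(P1)}$ (respectively $(\overline{\mathrm{P1}})$, respectively $\mathrm{(co)}$).
   Context: Banach spaces are real or complex. For a Banach space $X$, $B_X$ is the closed unit ball and $B(x,r)$ is the ball of centre $x$ and radius $r$. For $f\in B_{X^*}$ and $\varepsilon>0$, the slice of $B_X$ is $S(B_X,f,\varepsilon)=\{x\in B_X:\ \mathrm{Re}\, f(x)>\sup_{c\in B_X}|f(c)|-\varepsilon\}$. A convex combination of slices of $B_X$ is a set $\sum_{i=1}^n\lambda_i S_i=\{\sum_{i=1}^n \lambda_i x_i: x_i\in S_i\}$ with $n\in\mathbb{N}$, $\lambda_i>0$, $\sum_{i=1}^n\lambda_i=1$ and each $S_i$ a slice of $B_X$. $X$ has property $\mathrm{(P1)}$ (respectively $(\overline{\mathrm{P1}})$) if for every convex combination of slices $C$ of $B_X$ and every $x\in C$ there exists a relatively weakly open subset $W$ of $B_X$ with $x\in W\subseteq C$ (respectively $x\in W\subseteq\overline{C}$, norm closure). $X$ has property $\mathrm{(co)}$ if for every $n\in\mathbb{N}$, all $x_1,\dots,x_n\in B_X$, all $\lambda_1,\dots,\lambda_n>0$ with $\sum_{i=1}^n\lambda_i=1$ and every $\varepsilon>0$, there exist $\delta>0$ and continuous functions $\Phi_i:B(x_0,\delta)\cap B_X\to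 B(x_i,\varepsilon)\cap B_X$ ($i=1,\dots,n$), where $x_0=\sum_{i=1}^n\lambda_i x_i$, such that $y=\sum_{i=1}^n\lambda_i\Phi_i(y)$ for every $y\in B(x_0,\delta)\cap B_X$. *)

(* Defs.v *)
From HB Require Import structures.
From mathcomp Require Import all_boot all_order all_algebra.
From mathcomp Require Import complex.
From mathcomp Require Import all_classical all_reals all_analysis.

Set Implicit Arguments.
Unset Strict Implicit.
Unset Printing Implicit Defensive.

Import Order.TTheory GRing.Theory Num.Theory.
Import numFieldNormedType.Exports.

Local Open Scope classical_set_scope.
Local Open Scope ring_scope.

Variant scalar_kind := RealScalar | ComplexScalar.

Definition scalar_field (R : realType) (s : scalar_kind) : numFieldType :=
  match s with
  | RealScalar => R
  | ComplexScalar => R[i]%C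
  end.

(* Besides taking real parts, [re] turns norms, which MathComp valuates in the
   scalar field itself, into elements of [R], where suprema are available. *)
Definition re (R : realType) (s : scalar_kind) : scalar_field R s -> R :=
  match s return scalar_field R s -> R with
  | RealScalar => fun x => x
  | ComplexScalar => @complex.Re R
  end.

(* A positive element of [scalar_field R s] is a positive real number in the
   complex case too, so that positive weights and radii can be taken there. *)

Section geometry.
Context {R : realType} {s : scalar_kind}.
Local Notation K := (scalar_field R s).
Variable V : normedModType K.

Record dual := Dual {
  dual_fun :> {linear V -> K^o};
  dual_continuous : continuous dual_fun }.

Definition unit_ball : set V := [set x | `|x| <= 1].

Definition dual_norm (f : dual) : R := sup [set re `|f c| | c in unit_ball].

Definition dual_unit_ball : set dual := [set f | dual_norm f <= 1].

Definition slice (f : dual) (eps : R) : set V :=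
  [set x | unit_ball x /\ re (f x) > dual_norm f - eps].

Definition convex_combination_of_slices (C : set V) : Prop :=
  exists (n : nat) (lambda : 'I_n -> K) (f : 'I_n -> dual) (eps : 'I_n -> R),
    [/\ forall i, 0 < lambda i,
        \sum_i lambda i = 1,
        forall i, dual_unit_ball (f i),
        forall i, 0 < eps i &
        C = [set \sum_i lambda i *: x i |
              x in [set x : 'I_n -> V | forall i, slice (f i) (eps i) (x i)]]].

Definition weak : Type :=
  sup_topology (fun f : dual =>
    Topological.class (initial_topology (f : V -> K^o))).

HB.instance Definition _ := Topological.on weak.

Definition relatively_weakly_open (W : set V) : Prop :=
  exists2 O : set weak, open O & W = O `&` unit_ball.

Definition property_P1 : Prop :=
  forall (C : set V) (x : V), convex_combination_of_slices C -> C x ->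
    exists W : set V, [/\ relatively_weakly_open W, W x & W `<=` C].

Definition property_P1bar : Prop :=
  forall (C : set V) (x : V), convex_combination_of_slices C -> C x ->
    exists W : set V, [/\ relatively_weakly_open W, W x & W `<=` closure C].

Definition property_co : Prop :=
  forall (n : nat) (x : 'I_n -> V) (lambda : 'I_n -> K) (eps : K),
    (forall i, unit_ball (x i)) ->
    (forall i, 0 < lambda i) -> \sum_i lambda i = 1 -> 0 < eps ->
    let x0 := \sum_i lambda i *: x i in
    exists (delta : K) (Phi : 'I_n -> V -> V),
      let D := ball x0 delta `&` unit_ball in
      [/\ 0 < delta,
          forall i, {within D, continuous (Phi i)},
          forall i y, D y -> (ball (x i) eps `&` unit_ball) (Phi i y) &
          forall y, D y -> y = \sum_i lambda i *: Phi i y].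

End geometry.

Definition contractive_projection (K : numFieldType) (V : normedModType K)
    (P : {linear V -> V}) : Prop :=
  (forall x, P (P x) = P x) /\ (forall x, `|P x| <= `|x|).

Section range_space.
Variables (K : numFieldType) (V : normedModType K) (P : {linear V -> V}).

Definition in_range : pred V := fun x => x \in range P.

Definition range_space : Type := {x : V | in_range x}.

Fact in_range_submod_closed : submod_closed in_range.
Proof.
split.
  by rewrite /in_mem/= /in_range; apply/mem_set; exists 0; rewrite ?linear0.
move=> a x y; rewrite /in_mem/= /in_range => /set_mem[u _ <-] /set_mem[v _ <-].
by apply/mem_set; exists (a *: u + v); rewrite ?linearP.
Qed.

HB.instance Definition _ := SubChoice.on range_space.
HB.instance Definition _ :=
  GRing.SubChoice_isSubLmodule.Build K V in_range range_space
    in_range_submod_closed.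

Let norm (y : range_space) : K := `|val y|.

Let ler_normD (x y : range_space) : norm (x + y) <= norm x + norm y.
Proof. by rewrite /norm raddfD; exact: Num.Theory.ler_normD. Qed.

Let normrZ (a : K) (x : range_space) : norm (a *: x) = `|a| * norm x.
Proof. by rewrite /norm linearZ/= normed_module.normrZ. Qed.

Let normr0_eq0 (x : range_space) : norm x = 0 -> x = 0.
Proof. by move=> /Num.Theory.normr0_eq0 x0; apply: val_inj; rewrite x0 raddf0. Qed.

HB.instance Definition _ :=
  Lmodule_isNormed.Build K range_space ler_normD normrZ normr0_eq0.

End range_space.

(* Main.v *)
(* Only two facts about Y are used: it embeds in X by a linear contraction [i],
   and there is a linear contraction [q] from X to Y with [q \o i = id].
   Composing a functional with [q] preserves its norm and pulls slices of [B_Y]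
   back to slices of [B_X], so that a convex combination of slices of [B_Y]
   lifts to one of [B_X]; the weakly open sets found there are pulled back
   along [i].  For (co), the functions sought on Y are the [q \o Phi \o i]. *)

From HB Require Import structures.
Require Import Defs.
From mathcomp Require Import all_boot all_order all_algebra.
From mathcomp Require Import all_classical all_reals all_analysis.

Set Implicit Arguments.
Unset Strict Implicit.
Unset Printing Implicit Defensive.

Import Order.TTheory GRing.Theory Num.Theory.
Import numFieldNormedType.Exports.

Local Open Scope classical_set_scope.
Local Open Scope ring_scope.

Lemma linear_contraction_continuous (K : numFieldType) (U V : normedModType K)
    (f : {linear U -> V}) : (forall x, `|f x| <= `|x|) -> continuous f.
Proof.
move=> fle x; apply/cvgrPdist_lt => e e0; near=> y.
rewrite -linearB; apply: le_lt_trans (fle _) _.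
by near: y; exact: cvgr_dist_lt.
Unshelve. all: by end_near.
Qed.

Lemma continuous_image_closure (S T : topologicalType) (f : S -> T)
    (A : set S) : continuous f -> f @` closure A `<=` closure (f @` A).
Proof.
move=> fc _ [x Ax <-] B /fc /Ax[y [Ay By]].
by exists (f y); split => //; exists y.
Qed.

Section dual_comp.
Context {R : realType} {s : scalar_kind}.
Local Notation K := (scalar_field R s).
Variables (U V : normedModType K) (g : {linear U -> V}).

Lemma dual_comp_continuous (gc : continuous g) (f : dual V) :
  continuous (f \o g : U -> K^o).
Proof.
by move=> x; apply: continuous_comp; [exact: gc|exact: dual_continuous].
Qed.

(** The transpose (Banach space adjoint) of [g], applied to [f]. *)
Definition dual_comp (gc : continuous g) (f : dual V) : dual U :=
  Dual (dual_fun := (dual_fun f \o g)%FUN : {linear U -> K^o})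
    (dual_comp_continuous gc (f := f)).

(** It suffices to test against each functional [f] on [V], and [f \o g] is itself one of the
    functionals defining the weak topology of [U]. *)
Lemma weak_continuous : continuous g -> continuous (g : weak U -> weak V).
Proof.
move=> gc x; apply/cvg_sup; first exact/fmap_filter/nbhs_filter.
move=> f.
have cf : continuous (g : weak U -> initial_topology (f : V -> K^o)).
  apply: continuous_comp_initial => {}x.
  (* The trivial convergence of the identity is projected to the component of the supremum topology
     indexed by [f \o g]. *)
  have /cvg_sup/(_ (dual_comp gc f)) idx : nbhs (x : weak U) --> (x : weak U).
    exact: cvg_id.
  apply: cvg_trans (@initial_continuous _ _ (dual_comp gc f : U -> K^o) x).
  exact: (cvg_app _ idx).
exact: cf.
Qed.

End dual_comp.

Section retract.
Context {R : realType} {s : scalar_kind}.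
Local Notation K := (scalar_field R s).
Variables (U V : normedModType K) (i : {linear U -> V}) (q : {linear V -> U}).
Hypotheses (ile : forall x, `|i x| <= `|x|) (qle : forall x, `|q x| <= `|x|).
Hypothesis iK : cancel i q.

Let ic : continuous i := linear_contraction_continuous ile.
Let qc : continuous q := linear_contraction_continuous qle.

Lemma unit_ball_embed x : unit_ball x -> unit_ball (i x).
Proof. exact: le_trans (ile x). Qed.

Lemma unit_ball_retract x : unit_ball x -> unit_ball (q x).
Proof. exact: le_trans (qle x). Qed.

(** Since [q] maps the ball of [V] onto that of [U], both suprema range over the same set. Hence
    slices keep their threshold when pulled back along [q]. *)
Lemma dual_norm_retract (f : dual U) : dual_norm (dual_comp qc f) = dual_norm f.
Proof.
rewrite /dual_norm; congr sup; apply/seteqP; split => _ [x xB <-].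
  by exists (q x) => //; exact: unit_ball_retract.
by exists (i x); [exact: unit_ball_embed|rewrite /= iK].
Qed.

Lemma slice_retract (f : dual U) eps x :
  slice (dual_comp qc f) eps x -> slice f eps (q x).
Proof.
by rewrite /slice dual_norm_retract => -[xB fx]; split => //; exact: unit_ball_retract.
Qed.

Lemma slice_embed (f : dual U) eps x :
  slice f eps x -> slice (dual_comp qc f) eps (i x).
Proof.
rewrite /slice dual_norm_retract => -[xB fx].
by split; [exact: unit_ball_embed|rewrite /= iK].
Qed.

(** [D] keeps the weights and widths of [C]. The first inclusion carries a point of [C] into [D],
    the second brings what is found in [D] back to [C]. *)
Lemma convex_combination_of_slices_lift (C : set U) :
  convex_combination_of_slices C ->
  exists D : set V, [/\ convex_combination_of_slices D,
    i @` C `<=` D & q @` D `<=` C].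
Proof.
move=> [n [lambda [f [eps [lambda_gt0 lambda1 fB eps_gt0 ->]]]]].
exists [set \sum_j lambda j *: x j | x in
  [set x : 'I_n -> V | forall j, slice (dual_comp qc (f j)) (eps j) (x j)]].
split.
- exists n, lambda, (fun j => dual_comp qc (f j)), eps; split=> // j.
  by rewrite /dual_unit_ball /= dual_norm_retract; exact: fB.
- move=> _ [_ [x xS <-] <-]; exists (i \o x); first by move=> j; exact: slice_embed.
  by rewrite linear_sum; apply: eq_bigr => j _; rewrite linearZ.
- move=> _ [_ [x xS <-] <-]; exists (q \o x); first by move=> j; exact: slice_retract.
  by rewrite linear_sum; apply: eq_bigr => j _; rewrite linearZ.
Qed.

Lemma relatively_weakly_open_embed (W : set V) :
  relatively_weakly_open W -> relatively_weakly_open (i @^-1` W).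
Proof.
move=> [A Ao ->]; exists (i @^-1` A).
  by have /continuousP/(_ _ Ao) := weak_continuous ic.
apply/seteqP; split => x [xA xB]; split => //; last exact: unit_ball_embed.
(* As [x = q (i x)], the norm of [x] is at most that of [i x]. *)
by rewrite /= -[x]iK; exact: unit_ball_retract.
Qed.

Lemma property_P1_retract : property_P1 V -> property_P1 U.
Proof.
move=> VP1 C x /convex_combination_of_slices_lift[D [Dcs iCD qDC]] Cx.
have [||W [Wo Wix WD]] := VP1 D (i x); [by []|by apply: iCD; exists x|].
exists (i @^-1` W); split => //; first exact: relatively_weakly_open_embed.
by move=> y /WD Diy; apply: qDC; exists (i y).
Qed.

Lemma property_P1bar_retract : property_P1bar V -> property_P1bar U.
Proof.
move=> VP1 C x /convex_combination_of_slices_lift[D [Dcs iCD qDC]] Cx.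
have [||W [Wo Wix WD]] := VP1 D (i x); [by []|by apply: iCD; exists x|].
exists (i @^-1` W); split => //; first exact: relatively_weakly_open_embed.
move=> y /WD Diy; apply: (closureS qDC).
by apply: continuous_image_closure => //; exists (i y).
Qed.

Lemma property_co_retract : property_co V -> property_co U.
Proof.
move=> Vco n x lambda eps xB lambda_gt0 lambda1 eps_gt0 x0.
have [|delta [Phi [delta_gt0 Phic PhiB PhiE]]] :=
  Vco n (i \o x) lambda eps _ lambda_gt0 lambda1 eps_gt0.
  by move=> j; exact: unit_ball_embed.
have ix0 : \sum_j lambda j *: i (x j) = i x0.
  by rewrite linear_sum; apply: eq_bigr => j _; rewrite linearZ.
pose D : set V := ball (i x0) delta `&` @unit_ball _ _ V.
rewrite /= ix0 -/D in Phic PhiB PhiE.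
pose E : set U := ball x0 delta `&` @unit_ball _ _ U.
have ED y : E y -> D (i y).
  move=> [yx0 yB]; split; last exact: unit_ball_embed.
  move: yx0; rewrite -!ball_normE /= -linearB.
  exact: le_lt_trans (ile _).
exists delta, (fun j => q \o Phi j \o i); split => //.
- move=> j; apply/subspace_continuousP => y Ey.
  have /subspace_continuousP/(_ _ (ED _ Ey)) Phiy := Phic j.
  (* The neighbourhood [A] is pulled back through [q], then [Phi j] relative to [D], then [i]; [ED]
     discharges the restriction to [D]. *)
  move=> A /qc/Phiy/ic iA; apply: (filterS _ (iA : nbhs y _)) => z Az Ez.
  exact/Az/ED.
- move=> j y /ED/(PhiB j)[yx yB]; split; last exact: unit_ball_retract.
  move: yx; rewrite -!ball_normE /= -[in X in _ -> X](iK (x j)) -linearB.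
  exact: le_lt_trans (qle _).
(* Apply [q] to the decomposition of [i y]. *)
- move=> y /ED/PhiE yE; rewrite -[LHS]iK yE linear_sum.
  by apply: eq_bigr => j _; rewrite linearZ.
Qed.

End retract.

Section projection.
Variables (K : numFieldType) (V : normedModType K) (P : {linear V -> V}).

Definition to_range (x : V) : range_space P :=
  Sub (P x) (mem_set (ex_intro2 _ _ x I erefl) : in_range P (P x)).

Fact to_range_linear : linear to_range.
Proof. by move=> a x y; apply: val_inj; rewrite /= linearP. Qed.

HB.instance Definition _ :=
  GRing.isLinear.Build K V (range_space P) _ to_range to_range_linear.

(** An idempotent fixes its range pointwise. *)
Lemma valK_to_range : (forall x, P (P x) = P x) ->
  cancel (val : range_space P -> V) to_range.
Proof.
move=> PP y; apply: val_inj => /=.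
by have /set_mem[x _ <-] := valP y; exact: PP.
Qed.

End projection.

Theorem proposition2p3 (R : realType) (s : scalar_kind)
    (X : completeNormedModType (scalar_field R s))
    (P : {linear X -> X}) (hP : contractive_projection P) :
  (property_P1 X -> property_P1 (range_space P)) /\
  (property_P1bar X -> property_P1bar (range_space P)) /\
  (property_co X -> property_co (range_space P)).
Proof.
case: hP => PP Ple.
(* The norm of [range_space P] is by definition that of [val], so [val] serves as [i] and
   [to_range P] as [q]. *)
have vle (y : range_space P) : `|val y| <= `|y| by exact: lexx.
have tle (x : X) : `|to_range P x| <= `|x| by exact: Ple.
have vK := valK_to_range PP.
split; first exact: (property_P1_retract vle tle vK).
split; first exact: (property_P1bar_retract vle tle vK).
exact: (property_co_retract vle tle vK).
Qed.
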